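(* Let $G$ be a graph. Then $I^2[S]=I[S]$ for every set $S\subseteq V(G)$ (i.e., $G$ satisfies property $\mathcal P$) if and only if $G$ contains none of the following five graphs as an induced subgraph: the diamond ($K_4$ minus an edge), the paw (a triangle with one pendant vertex attached), the chair (the graph obtained from $K_{1,3}$ by subdividing one edge once), $K_{2,3}$, and the graph obtained from the chordless cycle $C_4$ by attaching one pendant vertex to one of its vertices.
   Context: Graphs are finite, simple and undirected. For $S\subseteq V(G)$, $I[S]=I_{P_3}[S]$ is $S$ together with all vertices of $G$ having at least two neighbors in $S$, and $I^2[S]=I[I[S]]$. Property $\mathcal P$ means that $I^2[S]=I[S]$ for every $S\subseteq V(G)$. *)

(* Defs.v *)
From mathcomp Require Import all_boot.
Set Implicit Arguments.
Unset Strict Implicit.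
Unset Printing Implicit Defensive.

Record sgraph := SGraph {
  vertex :> finType;
  adj : rel vertex;
  adj_sym : symmetric adj;
  adj_irrefl : irreflexive adj }.

Definition P3_interval (G : sgraph) (S : {set G}) : {set G} :=
  S :|: [set v | 2 <= #|[set u in S | adj v u]|].

Definition property_P (G : sgraph) : Prop :=
  forall S : {set G}, P3_interval (P3_interval S) = P3_interval S.

Definition contains_induced (G H : sgraph) : Prop :=
  exists f : H -> G, injective f /\ forall x y : H, adj (f x) (f y) = adj x y.

Section GraphOfEdges.
Variables (n : nat) (E : seq (nat * nat)).

(* Each unordered edge is listed once, in either direction. *)
Definition edges_adj : rel 'I_n :=
  fun x y => (x != y) &&
    (((val x, val y) \in E) || ((val y, val x) \in E)).

Lemma edges_adj_sym : symmetric edges_adj.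
Proof. by move=> x y; rewrite /edges_adj eq_sym orbC. Qed.

Lemma edges_adj_irrefl : irreflexive edges_adj.
Proof. by move=> x; rewrite /edges_adj eqxx. Qed.

Definition graph_of_edges : sgraph := SGraph edges_adj_sym edges_adj_irrefl.

End GraphOfEdges.

(* K_4 on {0,1,2,3} without the edge 23. *)
Definition diamond : sgraph :=
  graph_of_edges 4 [:: (0, 1); (0, 2); (0, 3); (1, 2); (1, 3)].

(* Triangle 012 with the pendant vertex 3 attached to 0. *)
Definition paw : sgraph :=
  graph_of_edges 4 [:: (0, 1); (0, 2); (1, 2); (0, 3)].

(* K_{1,3} with center 0 and leaves 1, 2, 4, its edge 04 subdivided by 3. *)
Definition chair : sgraph :=
  graph_of_edges 5 [:: (0, 1); (0, 2); (0, 3); (3, 4)].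

(* Parts {0,1} and {2,3,4}. *)
Definition K23 : sgraph :=
  graph_of_edges 5 [:: (0, 2); (0, 3); (0, 4); (1, 2); (1, 3); (1, 4)].

(* Cycle 0123 with the pendant vertex 4 attached to 0. *)
Definition C4_pendant : sgraph :=
  graph_of_edges 5 [:: (0, 1); (1, 2); (2, 3); (3, 0); (0, 4)].

(* Main.v *)
Require Import Defs.
From mathcomp Require Import all_boot.

Set Implicit Arguments.
Unset Strict Implicit.
Unset Printing Implicit Defensive.

(** Property P passes to induced subgraphs ([property_P_hereditary]), because
    an induced embedding reflects membership in the interval of an image and
    the interval is monotone. So it is enough, for necessity, to find in each
    of the five graphs a set whose interval is not closed.

    For sufficiency, suppose that none of the five graphs is induced in G.
    Without diamonds and paws, a vertex outside a triangle that sees one of its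
    vertices sees all of them ([triangle_nbr]). Without the other three graphs
    as well, if [x] has distinct neighbours [a], [b], [v] with [v] adjacent
    neither to [a] nor to [b], then [x] is the only neighbour of [v]
    ([claw_leaf_pendant]): any further neighbour [y] of [v] is
    not adjacent to [x], and [x], [a], [b], [v], [y] induce a chair, a
    [C_4] with a pendant vertex, or [K_{2,3}], according to whether [y] sees
    none, one or both of [a], [b].

    Now let [v] be added by the second step and not by the first. Then [v] has
    two neighbours in I[S], one of which, [x], lies outside S and so has
    neighbours [a], [b] in S. As [v] has another neighbour besides [x], it must
    see [a] or [b]; with [x] this makes a triangle, so [v] sees both and was
    already added in the first step. *)

(** * The interval operator *)

Lemma P3_intervalP (G : sgraph) (S : {set G}) (v : G) :
  reflect (v \in S \/
           exists a b, [/\ a != b, a \in S, b \in S, adj v a & adj v b])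
          (v \in P3_interval S).
Proof.
rewrite !inE; apply: (iffP orP) => -[vS|]; try by left.
- case/card_gt1P=> a [b []]; rewrite !inE => /andP[aS va] /andP[bS vb] ab.
  by right; exists a, b.
- case=> a [b [ab aS bS va vb]]; right; apply/card_gt1P; exists a, b.
  by rewrite !inE aS bS va vb.
Qed.

Lemma sub_P3_interval (G : sgraph) (S : {set G}) : S \subset P3_interval S.
Proof. exact: subsetUl. Qed.

Lemma mem_P3_interval (G : sgraph) (S : {set G}) (v a b : G) :
  a != b -> a \in S -> b \in S -> adj v a -> adj v b -> v \in P3_interval S.
Proof. by move=> *; apply/P3_intervalP; right; exists a, b. Qed.

Lemma P3_intervalS (G : sgraph) (S T : {set G}) :
  S \subset T -> P3_interval S \subset P3_interval T.
Proof.
move=> /subsetP ST; apply/subsetP => v /P3_intervalP[/ST vT | ].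
  exact: (subsetP (sub_P3_interval T)).
by case=> a [b [ab /ST aT /ST bT va vb]]; apply: mem_P3_interval ab _ _ va vb.
Qed.

(** * Necessity *)

(** The points of an image under an embedding are images of points, so
    neighbours of [f v] in [f @: S] come from neighbours of [v] in [S]. *)
Lemma P3_interval_imset (G H : sgraph) (f : H -> G) (S : {set H}) (v : H) :
  injective f -> (forall x y, adj (f x) (f y) = adj x y) ->
  (f v \in P3_interval (f @: S)) = (v \in P3_interval S).
Proof.
move=> f_inj f_adj; apply/P3_intervalP/P3_intervalP => -[].
- by rewrite mem_imset //; left.
- case=> a' [b' [ab /imsetP[a aS ea] /imsetP[b bS eb]]]; subst a' b'.
  rewrite !f_adj => va vb; right; exists a, b; split=> //.
  by apply: contraNneq ab => ->.
- by move=> vS; left; rewrite mem_imset.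
- case=> a [b [ab aS bS va vb]]; right; exists (f a), (f b).
  by rewrite !mem_imset // !f_adj (inj_eq f_inj).
Qed.

Lemma property_P_hereditary (G H : sgraph) :
  contains_induced G H -> property_P G -> property_P H.
Proof.
case=> f [f_inj f_adj] PG S; apply/eqP; rewrite eqEsubset sub_P3_interval andbT.
apply/subsetP => v; rewrite -!(P3_interval_imset _ _ f_inj f_adj).
rewrite -(PG (f @: S)).
apply/subsetP/P3_intervalS/subsetP => _ /imsetP[u uS ->].
by rewrite P3_interval_imset.
Qed.

(** The five graphs refute P with [S], [x], [y], [v] as follows: the first
    step adds [x] (and [y], unless [y] is already in [S]), and only then does
    [v] have two neighbours. *)
Lemma property_P_refuted (H : sgraph) (S : {set H}) (v x y : H) :
  x != y -> x \in P3_interval S -> y \in P3_interval S ->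
  adj v x -> adj v y -> v \notin P3_interval S -> ~ property_P H.
Proof.
move=> xy xI yI vx vy vI PH; case/negP: vI; rewrite -PH.
exact: mem_P3_interval xy xI yI vx vy.
Qed.

Local Notation ord n k := (@Ordinal n k isT).

(* Closes [v \notin P3_interval S] by running through all pairs of vertices. *)
Local Ltac not_in_interval :=
  apply/negP => /P3_intervalP[]; [by rewrite !inE |];
  case=> -[[|[|[|[|[|?]]]]] ?] [[[|[|[|[|[|?]]]]] ?] []];
  by rewrite // !inE.

Lemma diamond_not_P : ~ property_P diamond.
Proof.
pose S : {set diamond} := [set i : 'I_4 | val i \in [:: 0; 2]].
apply: (@property_P_refuted diamond S (ord 4 3) (ord 4 1) (ord 4 0)) => //.
- by apply: (@mem_P3_interval diamond _ _ (ord 4 0) (ord 4 2)); rewrite ?inE.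
- by apply: (subsetP (sub_P3_interval S)); rewrite !inE.
- not_in_interval.
Qed.

Lemma paw_not_P : ~ property_P paw.
Proof.
pose S : {set paw} := [set i : 'I_4 | val i \in [:: 1; 3]].
apply: (@property_P_refuted paw S (ord 4 2) (ord 4 0) (ord 4 1)) => //.
- by apply: (@mem_P3_interval paw _ _ (ord 4 1) (ord 4 3)); rewrite ?inE.
- by apply: (subsetP (sub_P3_interval S)); rewrite !inE.
- not_in_interval.
Qed.

Lemma chair_not_P : ~ property_P chair.
Proof.
pose S : {set chair} := [set i : 'I_5 | val i \in [:: 1; 2; 4]].
apply: (@property_P_refuted chair S (ord 5 3) (ord 5 0) (ord 5 4)) => //.
- by apply: (@mem_P3_interval chair _ _ (ord 5 1) (ord 5 2)); rewrite ?inE.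
- by apply: (subsetP (sub_P3_interval S)); rewrite !inE.
- not_in_interval.
Qed.

Lemma K23_not_P : ~ property_P K23.
Proof.
pose S : {set K23} := [set i : 'I_5 | val i \in [:: 2; 3]].
apply: (@property_P_refuted K23 S (ord 5 4) (ord 5 0) (ord 5 1)) => //.
- by apply: (@mem_P3_interval K23 _ _ (ord 5 2) (ord 5 3)); rewrite ?inE.
- by apply: (@mem_P3_interval K23 _ _ (ord 5 2) (ord 5 3)); rewrite ?inE.
- not_in_interval.
Qed.

Lemma C4_pendant_not_P : ~ property_P C4_pendant.
Proof.
pose S : {set C4_pendant} := [set i : 'I_5 | val i \in [:: 1; 2; 4]].
apply: (@property_P_refuted C4_pendant S (ord 5 3) (ord 5 0) (ord 5 2)) => //.
- by apply: (@mem_P3_interval C4_pendant _ _ (ord 5 1) (ord 5 4)); rewrite ?inE.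
- by apply: (subsetP (sub_P3_interval S)); rewrite !inE.
- not_in_interval.
Qed.

(** * Sufficiency *)

(** By symmetry and irreflexivity, only the pairs [i < j] have to be compared;
    the boolean form reduces, on a concrete graph, to the finitely many
    adjacencies between the entries of [s]. *)
Lemma contains_induced_seq (G : sgraph) (n : nat) (E : seq (nat * nat))
    (x0 : G) (s : seq G) :
  size s = n -> uniq s ->
  all (fun i => all (fun j => (i < j) ==>
    (adj (nth x0 s i) (nth x0 s j) == ((i, j) \in E) || ((j, i) \in E)))
    (iota 0 n)) (iota 0 n) ->
  contains_induced G (graph_of_edges n E).
Proof.
move=> sz_s s_uniq adj_s.
have adjE (i j : 'I_n) : i < j ->
    adj (nth x0 s i) (nth x0 s j) = edges_adj E i j.
  move=> ij; have:= allP adj_s i; rewrite mem_iota ltn_ord => /(_ isT).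
  move=> /allP/(_ j); rewrite mem_iota ltn_ord ij => /(_ isT)/eqP ->.
  by rewrite /edges_adj -val_eqE /= ltn_eqF.
exists (fun i : 'I_n => nth x0 s i); split=> [i j /eqP | i j].
  by rewrite nth_uniq ?sz_s // => /eqP/val_inj.
case: (ltngtP i j) => [/adjE // | /adjE ji | /val_inj ->].
  by rewrite adj_sym ji edges_adj_sym.
by rewrite !adj_irrefl.
Qed.

Lemma adj_neq (G : sgraph) (x y : G) : adj x y -> x != y.
Proof. by apply: contraTneq => ->; rewrite adj_irrefl. Qed.

(** A vertex seeing exactly one vertex of a triangle gives a paw; one seeing
    exactly two gives a diamond. *)
Lemma triangle_nbr (G : sgraph) (v x y b : G) :
  ~ contains_induced G diamond -> ~ contains_induced G paw ->
  adj x v -> adj x y -> adj v y -> adj x b -> v != b -> adj v b.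
Proof.
move=> noD noP xv xy vy xb vb; apply/idP; apply: contraT => /negbTE nvb.
have yv : adj y v by rewrite adj_sym.
have yb : y != b by apply: contraTneq vy => ->; rewrite nvb.
case yb_adj : (adj y b).
- case: noD; apply: (@contains_induced_seq _ _ _ x [:: x; y; v; b]) => //=.
    by rewrite !inE !negb_or vb !adj_neq.
  by rewrite xy xv xb yv yb_adj nvb.
- case: noP; apply: (@contains_induced_seq _ _ _ x [:: x; v; y; b]) => //=.
    by rewrite !inE !negb_or vb yb !adj_neq.
  by rewrite xv xy xb vy nvb yb_adj.
Qed.

(** If [y] differs from [x], then neither [ab] nor [xy] is an edge: either one
    would make a triangle at [x] that, by [triangle_nbr], forces [v] to see
    [a]. The edges from [y] to [a] and [b] are then the only ones
    left undetermined, and each possibility is excluded. *)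
Lemma claw_leaf_pendant (G : sgraph) (x a b v y : G) :
  ~ contains_induced G diamond -> ~ contains_induced G paw ->
  ~ contains_induced G chair -> ~ contains_induced G K23 ->
  ~ contains_induced G C4_pendant ->
  adj x a -> adj x b -> adj x v -> a != b ->
  ~~ adj v a -> ~~ adj v b -> v != a -> v != b ->
  adj v y -> y = x.
Proof.
move=> noD noP noC noK noC4 xa xb xv ab nva nvb va vb vy.
apply/eqP; apply: contraT => yx.
have nab : adj a b = false.
  apply: contraNF nva => ab_adj; rewrite adj_sym.
  by apply: (triangle_nbr noD noP xa xb) => //; rewrite eq_sym.
have nxy : adj x y = false.
  by apply: contraNF nva => xy; apply: (triangle_nbr noD noP xv xy).
have ya : y != a by apply: contraTneq vy => ->.
have yb : y != b by apply: contraTneq vy => ->.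
have xy : x != y by rewrite eq_sym.
have av : a != v by rewrite eq_sym.
have bv : b != v by rewrite eq_sym.
have ay : a != y by rewrite eq_sym.
have by_ : b != y by rewrite eq_sym.
have ba : b != a by rewrite eq_sym.
have nav : adj a v = false by rewrite adj_sym; apply: negbTE.
have nbv : adj b v = false by rewrite adj_sym; apply: negbTE.
have nba : adj b a = false by rewrite adj_sym.
have yv : adj y v by rewrite adj_sym.
move/negbTE in nva; move/negbTE in nvb.
case ya_adj : (adj y a); case yb_adj : (adj y b);
  have ay_adj := ya_adj; have by_adj := yb_adj; rewrite adj_sym in ay_adj;
  rewrite adj_sym in by_adj.
- case: noK; apply: (@contains_induced_seq _ _ _ x [:: x; y; a; b; v]) => //=.
    by rewrite !inE !negb_or ab av bv ya yb xy !adj_neq.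
  by rewrite nxy xa xb xv ya_adj yb_adj yv nab nav nbv.
- case: noC4; apply: (@contains_induced_seq _ _ _ x [:: x; a; y; v; b]) => //=.
    by rewrite !inE !negb_or ay av ab yb vb xy !adj_neq.
  by rewrite nxy xa xb xv ay_adj yb_adj yv nab nav nvb.
- case: noC4; apply: (@contains_induced_seq _ _ _ x [:: x; b; y; v; a]) => //=.
    by rewrite !inE !negb_or by_ bv ba ya va xy !adj_neq.
  by rewrite nxy xa xb xv by_adj ya_adj yv nba nbv nva.
- case: noC; apply: (@contains_induced_seq _ _ _ x [:: x; a; b; v; y]) => //=.
    by rewrite !inE !negb_or ab av ay bv by_ xy !adj_neq.
  by rewrite xa xb xv nxy nab nav ay_adj nbv by_adj vy.
Qed.

Theorem theorem8 (G : sgraph) :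
  property_P G <->
  ~ contains_induced G diamond /\ ~ contains_induced G paw /\
  ~ contains_induced G chair /\ ~ contains_induced G K23 /\
  ~ contains_induced G C4_pendant.
Proof.
split=> [PG | [noD [noP [noC [noK noC4]]]] S].
  by do !split; move=> /property_P_hereditary/(_ PG);
    [apply: diamond_not_P | apply: paw_not_P | apply: chair_not_P
    | apply: K23_not_P | apply: C4_pendant_not_P].
apply/eqP; rewrite eqEsubset sub_P3_interval andbT; apply/subsetP => v.
case/P3_intervalP=> // -[x [y [xy xI yI vx vy]]]; apply: contraT => vI.
have vS : v \notin S by apply: contra vI; apply/subsetP/sub_P3_interval.
wlog xS : x y xy xI yI vx vy / x \notin S => [reduce|].
  case xS: (x \in S); last by apply: (reduce x y) => //; rewrite xS.
  case yS: (y \in S); first by rewrite (mem_P3_interval xy xS yS vx vy) in vI.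
  by apply: (reduce y x) => //; rewrite ?yS // eq_sym.
have [xS' | [a [b [ab aS bS xa xb]]]] := P3_intervalP _ _ xI.
  by rewrite xS' in xS.
have va : v != a by apply: contraNneq vS => ->.
have vb : v != b by apply: contraNneq vS => ->.
have xv : adj x v by rewrite adj_sym.
(* Seeing one of [a] and [b], [v] sees both, by the triangle it forms with
   that one and [x]. *)
have nva : ~~ adj v a.
  apply: contra vI => va_adj; apply: (mem_P3_interval ab aS bS va_adj).
  exact: (triangle_nbr noD noP xv xa va_adj xb vb).
have nvb : ~~ adj v b.
  apply: contra nva => vb_adj.
  exact: (triangle_nbr noD noP xv xb vb_adj xa va).
have yx := claw_leaf_pendant noD noP noC noK noC4 xa xb xv ab nva nvb va vb vy.
by rewrite yx eqxx in xy.
Qed.
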